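(* Let $d>1$ be a square-free integer, let $F=\mathbb{Q}(\sqrt{d})$, and let $\Delta_d$ be the discriminant of $F$. If $$\Delta_d>(29524500000005)^2,$$ then there is no positive definite classic universal quadratic $\mathcal{O}_F$-lattice of rank $7$.
   Context: $\mathcal{O}_F$ is the ring of algebraic integers of $F=\mathbb{Q}(\sqrt d)$, and $\mathcal{O}_F^+\subset\mathcal{O}_F$ is the set of totally positive elements (those that are positive under both real embeddings of $F$). The discriminant is $\Delta_d=4d$ if $d\equiv 2,3 \pmod 4$ and $\Delta_d=d$ if $d\equiv 1\pmod 4$. A quadratic $\mathcal{O}_F$-lattice is a finitely generated $\mathcal{O}_F$-module $L$ (not necessarily free) equipped with a quadratic map $Q:L\to\mathcal{O}_F$ for which $B(x,y):=\frac{Q(x+y)-Q(x)-Q(y)}{2}$ is a symmetric $\mathcal{O}_F$-bilinear form on $L$ (with values in $F$) with $B(x,x)=Q(x)$. It is classic if $B(x,y)\in\mathcal{O}_F$ for all $x,y\in L$. It is positive definite if $Q(x)\in\mathcal{O}_F^+$ for all $x\in L\setminus\{0\}$. A positive definite quadratic $\mathcal{O}_F$-lattice $L$ is universal if $Q(L)=\mathcal{O}_F^+\cup\{0\}$. The rank of $L$ is $\dim_F(F\otimes_{\mathcal{O}_F}L)$. *)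

(* Defs.v *)
From HB Require Import structures.
From mathcomp Require Import all_boot all_order all_algebra all_field.
From mathcomp Require Import boolp reals.

Set Implicit Arguments.
Unset Strict Implicit.
Unset Printing Implicit Defensive.

Import Order.TTheory GRing.Theory Num.Theory.

Local Open Scope ring_scope.

Definition squarefree (d : nat) : Prop :=
  forall p : nat, prime p -> ~~ (p ^ 2 %| d)%N.

Definition quad_disc (d : nat) : nat :=
  if (d %% 4 == 1)%N then d else (4 * d)%N.

(* F is Q(sqrt d): it is generated over the prime field Q by a square root
   of d. *)
Definition is_quadratic_field (d : nat) (F : fieldExtType rat) : Prop :=
  exists s : F, s ^+ 2 = d%:R /\ <<1; s>>%VS = fullv.

Section RingOfIntegers.
Variable F : fieldExtType rat.

Definition is_int : {pred F} :=
  fun x => `[< integralOver (intr : int -> F) x >].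

Fact is_int_subring : subring_closed is_int.
Proof.
split; first exact/asboolP/integral1.
- by move=> x y /asboolP hx /asboolP hy; exact/asboolP/integral_sub.
- by move=> x y /asboolP hx /asboolP hy; exact/asboolP/integral_mul.
Qed.

HB.instance Definition _ := GRing.isSubringClosed.Build F is_int is_int_subring.

Record int_ring := IntRing { int_val :> F; _ : int_val \in is_int }.

HB.instance Definition _ := [isSub for int_val].
HB.instance Definition _ := [Choice of int_ring by <:].
HB.instance Definition _ := [SubChoice_isSubComNzRing of int_ring by <:].
HB.instance Definition _ := GRing.RMorphism.copy int_val (val : int_ring -> F).

End RingOfIntegers.

Section Lattices.
Variable F : fieldExtType rat.
Local Notation OF := (int_ring F).

Definition fin_generated (L : lmodType OF) : Prop :=
  exists (n : nat) (g : 'I_n -> L),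
    forall x : L, exists c : 'I_n -> OF, x = \sum_(i < n) c i *: g i.

Definition polar (L : lmodType OF) (Q : L -> OF) (x y : L) : F :=
  (int_val (Q (x + y)) - int_val (Q x) - int_val (Q y)) / 2%:R.

(* B(-, y) and B(x, -) are O_F-linear into F, on which a in O_F acts as
   multiplication by int_val a. *)
Record quad_lattice := QuadLattice {
  lat_module :> lmodType OF;
  quad_form : lat_module -> OF;
  bil_form := polar quad_form;
  _ : fin_generated lat_module;
  _ : forall x y, bil_form x y = bil_form y x;
  _ : forall y, linear_for (@int_val F \; *%R) (bil_form^~ y);
  _ : forall x, linear_for (@int_val F \; *%R) (bil_form x);
  _ : forall x, bil_form x x = int_val (quad_form x)
}.

Definition classic (L : quad_lattice) : Prop :=
  forall x y : L, bil_form x y \in @is_int F.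

(* V, with iota : L -> V, is the extension of scalars of L along O_F -> F,
   i.e. the tensor product of F and L over O_F with iota x = 1 (x) x,
   characterized by its universal property. *)
Definition is_scalar_extension (L : lmodType OF) (V : lmodType F)
    (iota : L -> V) : Prop :=
  linear_for (@int_val F \; *:%R) iota /\
  forall (W : lmodType F) (f : L -> W),
    linear_for (@int_val F \; *:%R) f ->
    exists g : {linear V -> W},
      (forall x, g (iota x) = f x) /\
      forall h : {linear V -> W}, (forall x, h (iota x) = f x) -> h =1 g.

Definition has_rank (L : lmodType OF) (n : nat) : Prop :=
  exists (V : vectType F) (iota : L -> V),
    is_scalar_extension iota /\ \dim {:V} = n.

End Lattices.

Section Positivity.
Variables (R : realType) (F : fieldExtType rat).
Local Notation OF := (int_ring F).

(* The real embeddings of F are the ring morphisms F -> R. *)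
Definition totally_positive (a : OF) : Prop :=
  forall sigma : {rmorphism F -> R}, 0 < sigma (int_val a).

Definition positive_definite (L : quad_lattice F) : Prop :=
  forall x : L, x <> 0 -> totally_positive (quad_form x).

Definition universal (L : quad_lattice F) : Prop :=
  forall a : OF,
    (exists x : L, quad_form x = a) <-> totally_positive a \/ a = 0.

End Positivity.

(* Main.v *)
From HB Require Import structures.
Require Import Defs.
From mathcomp Require Import all_boot all_order all_algebra all_field.
From mathcomp Require Import reals zify ring lra.
From mathcomp Require boolp.

(** Write Q = p + b * omega in the integral basis 1, omega of O_F, and let s1, s2
    be the real embeddings, numbered so that s1 Q - s2 Q = b * sqrt Delta.  The
    coordinates p and b turn the lattice L into two integral Z-forms.  Neither is
    positive definite on L, but each is nonnegative on short vectors, because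
    sqrt Delta is enormous:

    - a vector that is short under both embeddings has b = 0, so that Q = p is a
      positive rational integer ([small_irr_part0], [small_rat_part_ge0]);
    - a vector x that is short under s2 alone has b x x >= 0, since otherwise
      s1 Q would be negative ([irr_part_ge0]).

    Universality makes both forms represent every t <= 21 on short vectors: Q = t
    gives p = t, and the smallest totally positive element a + t * omega, whose
    image under s2 lies in ]0, 1], gives b = t ([rat_part_represents],
    [irr_part_represents]).

    A positive integral Z-form representing so many integers has rank at least 4.
    This is the escalation behind the Fifteen Theorem: starting from no vector at
    all, some small integer is missed over the rationals by the form spanned so
    far, so that a vector representing it has a nonzero component orthogonal to
    that span.  For ternary forms the missed integer exists because a positive
    definite ternary form is anisotropic at some prime.  Gram-Schmidt steps turn
    this into [orthogonal_escalation], which yields four orthogonal vectors of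
    positive norm; as positivity holds for short vectors only, the lengths of all
    the vectors formed on the way are bounded as well.

    Thus L contains w_1, ..., w_4 orthogonal for Q, with b = 0, and v_1, ..., v_4
    orthogonal for b with b v_i v_i = n_i > 0; moreover b v_i w_j = 0.  If G is the
    Gram matrix of the eight vectors, then s1 G is s2 G plus sqrt Delta times the
    diagonal matrix (0, 0, 0, 0, n_1, ..., n_4).  Let c be a linear relation
    between the vectors, with coefficients in O_F, and tau the conjugation of F,
    so that s1 = s2 o tau.  With u_i running over the eight vectors and
    z = sum_i tau c_i * u_i,

      0 <= s2 (Q z) = s1 c^T * s2 G * s1 c = - sqrt Delta * sum_i n_i * (s1 c_i)^2,

    hence the coefficients of the v_i vanish, and then those of the orthogonal
    w_i ([orthogonal_independent]).  So the rank is at least 8 ([rank_ge8]). *)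

Set Implicit Arguments.
Unset Strict Implicit.
Unset Printing Implicit Defensive.

Import Order.TTheory GRing.Theory Num.Theory.

Local Open Scope ring_scope.

(** * Integrality over Z *)

(** The rational root theorem, read off from the algebraic integers in C. *)
Lemma integral_rat_int (x : rat) : integralOver intr x -> x \is a Num.int.
Proof.
case=> p p_monic px0; rewrite -Cint_rat; apply: Cint_rat_Aint; first exact: Crat_rat.
apply: (@root_monic_Aint (map_poly intr p)).
- have -> : map_poly (intr : int -> algC) p =
      map_poly ratr (map_poly (intr : int -> rat) p).
    by rewrite -map_poly_comp; apply: eq_map_poly => m /=; rewrite ratr_int.
  by rewrite fmorph_root.
- exact: monic_map.
- by apply/polyOverP => i; rewrite coef_map; exact: intr_int.
Qed.

(** The square of the denominator of y is prime to its numerator, so it divides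
    the squarefree d. *)
Lemma squarefree_scaled_square_int (d : nat) (y : rat) :
  squarefree d -> d%:R * y ^+ 2 \is a Num.int -> y \is a Num.int.
Proof.
move=> d_sqf /intrP[N dy2]; rewrite Qint_def.
have eqN : (d * `|numq y| ^ 2 = `|N| * `|denq y| ^ 2)%N.
  have : (d%:Z * numq y ^+ 2)%:~R = (N * denq y ^+ 2)%:~R :> rat.
    by rewrite !(rmorphXn, rmorphM) /= -dy2 -mulrA -exprMn -numqE.
  by move/intr_inj/(congr1 absz); rewrite !(abszX, abszM).
have m2_dvd : (`|denq y| ^ 2 %| d)%N.
  have co : coprime (`|denq y| ^ 2) (`|numq y| ^ 2).
    by rewrite coprimeXl // coprimeXr // coprime_sym coprime_num_den.
  by rewrite -(Gauss_dvdl _ co) eqN dvdn_mull.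
have m_gt0 : (0 < `|denq y|)%N by rewrite absz_gt0 denq_neq0.
suff : `|denq y|%N == 1%N by have := denq_gt0 y; lia.
apply: contraT => m_neq1; have [|p p_pr p_dvd] := @pdivP `|denq y|; first by lia.
by have := d_sqf p p_pr; rewrite (dvdn_trans _ m2_dvd) // dvdn_exp2r.
Qed.

Lemma rat_is_int_intr (F : fieldExtType rat) (p : rat) :
  p%:A \in @is_int F -> p \is a Num.int.
Proof.
move=> /boolp.asboolP[q q_monic qp0]; apply: integral_rat_int; exists q => //.
move: qp0; have -> : map_poly (intr : int -> F) q =
    map_poly (in_alg F) (map_poly (intr : int -> rat) q).
  by rewrite -map_poly_comp; apply: eq_map_poly => m /=; rewrite scaler_int.
by rewrite -[p%:A]/(in_alg F p) fmorph_root.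
Qed.

Lemma rmorph_is_int (F : fieldExtType rat) (f : {rmorphism F -> F}) x :
  x \in @is_int F -> f x \in @is_int F.
Proof.
move=> /boolp.asboolP[q q_monic qx0]; apply/boolp.asboolP; exists q => //.
have -> : map_poly (intr : int -> F) q = map_poly f (map_poly (intr : int -> F) q).
  by rewrite -map_poly_comp; apply: eq_map_poly => m /=; rewrite rmorph_int.
by rewrite fmorph_root.
Qed.

(** * Quadratic fields and their rings of integers *)

Section QuadraticField.

Variables (d : nat) (F : fieldExtType rat) (s : F).
Hypotheses (d_gt1 : (1 < d)%N) (d_sqf : squarefree d).
Hypotheses (s2 : s ^+ 2 = d%:R) (Fs : <<1; s>>%VS = fullv).

Lemma quad_coord (x : F) : exists c : rat * rat, x = c.1%:A + c.2 *: s.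
Proof.
have /Fadjoin_polyP[p /polyOverP p1 ->] : x \in <<1; s>>%VS by rewrite Fs memvf.
elim/poly_ind: p p1 => [|p c IHp] p1.
  by exists (0, 0); rewrite horner0 !scale0r addr0.
have [|[a b] /= ab] := IHp.
  by move=> i; have := p1 i.+1; rewrite coefD coefMX coefC addr0.
have /vlineP[k ck] : c \in 1%VS by have := p1 0%N; rewrite coefD coefMX coefC add0r.
exists (b * d%:R + k, a); rewrite hornerMXaddC ab ck /=.
rewrite mulrDl -!scalerAl mul1r -expr2 s2 scalerDl -scalerA scaler_nat.
by rewrite -addrA addrC.
Qed.

Lemma quad_coordE (p q : rat) : p%:A + q *: s = in_alg F p + in_alg F q * s.
Proof. by rewrite mulr_algl. Qed.

(** If s = q, then d * q^-2 = 1 makes q^-1 an integer, so that d would divide 1. *)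
Lemma irrational_quad_gen (q : rat) : q%:A != s.
Proof.
apply/eqP => qs; have qd : q ^+ 2 = d%:R.
  have : in_alg F (q ^+ 2) = in_alg F d%:R by rewrite rmorphXn rmorph_nat -s2 -qs.
  exact: fmorph_inj.
have q0 : q != 0 by apply: contra_eq_neq qd => ->; rewrite expr0n eq_sym pnatr_eq0; lia.
have /intrP[m qm] : q^-1 \is a Num.int.
  apply: (@squarefree_scaled_square_int d) => //.
  by rewrite exprVn qd divff ?rpred1 // pnatr_eq0; lia.
have : (d%:Z * m ^+ 2)%:~R = 1 :> rat.
  by rewrite rmorphM rmorphXn /= -qm -pmulrn -qd exprVn divff // expf_neq0.
move/eqP; rewrite -[1]/(1%:~R) eqr_int => /eqP/(congr1 absz).
by rewrite abszM => /eqP; rewrite muln_eq1; lia.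
Qed.

Lemma quad_coord_inj (p q p' q' : rat) :
  p%:A + q *: s = p'%:A + q' *: s -> p = p' /\ q = q'.
Proof.
move=> e; suff qq : q = q'.
  by split=> //; move: e; rewrite qq => /addIr/(fmorph_inj (in_alg F)).
apply/eqP/negP => /negP nqq; have := irrational_quad_gen ((p' - p) / (q - q')).
move/eqP; apply; have : (q - q') *: s = (p' - p)%:A.
  by rewrite !scalerBl -[q *: s](addKr p%:A) e addrA addrK addrC.
move/(congr1 (GRing.scale (q - q')^-1)); rewrite scalerA mulVf ?subr_eq0 // scale1r.
by rewrite scalerA mulrC => <-.
Qed.

(** Only the coordinates on the basis 1, s are at hand to define a morphism, so the
    ring laws are checked on them.  This gives both real embeddings of F as well
    as its conjugation. *)
Lemma quad_rmorphism (K : comNzRingType) (k : {rmorphism rat -> K}) (r : K) :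
  r ^+ 2 = d%:R ->
  exists f : {rmorphism F -> K}, forall p q, f (p%:A + q *: s) = k p + k q * r.
Proof.
move=> r2; pose c x := projT1 (boolp.cid (quad_coord x)).
pose f x := k (c x).1 + k (c x).2 * r.
have fE p q : f (p%:A + q *: s) = k p + k q * r.
  rewrite /f /c; case: boolp.cid => -[p' q'] /= e.
  by have [-> ->] := quad_coord_inj e.
have f_add : zmod_morphism f.
  move=> x y; have [[p q] ->] := quad_coord x; have [[p' q'] ->] := quad_coord y => /=.
  rewrite opprD addrACA -!scalerBl !fE !rmorphB; ring.
have f_mul : monoid_morphism f.
  split; first by have := fE 1 0; rewrite scale1r scale0r addr0 rmorph0 mul0r addr0 rmorph1.
  move=> x y; have [[p q] ->] := quad_coord x; have [[p' q'] ->] := quad_coord y => /=.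
  have -> : (p%:A + q *: s) * (p'%:A + q' *: s) =
      (p * p' + q * q' * d%:R)%:A + (p * q' + q * p') *: s.
    by rewrite !quad_coordE !(rmorphD, rmorphM) rmorph_nat -s2; ring.
  by rewrite !fE !(rmorphD, rmorphM) rmorph_nat -r2; ring.
pose fm : {rmorphism F -> K} := HB.pack f
  (GRing.isZmodMorphism.Build F K f f_add)
  (GRing.isMonoidMorphism.Build F K f f_mul).
by exists fm.
Qed.

Lemma integral_quadratic (x : F) (t n : int) :
  x ^+ 2 = t%:~R * x + n%:~R -> x \in @is_int F.
Proof.
move=> x2; apply/boolp.asboolP; exists ('X^2 - (t%:P * 'X + n%:P)).
  rewrite monicE lead_coefDl ?lead_coefXn // size_polyXn size_polyN.
  by rewrite size_MXaddC size_polyC; case: ifP => // _; case: (t != 0).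
rewrite rootE rmorphB rmorphD /= map_polyXn rmorphM /= !map_polyC map_polyX.
by rewrite !hornerE x2 /= subrr.
Qed.

Lemma quad_gen_is_int : s \in @is_int F.
Proof. by apply: (@integral_quadratic s 0 d); rewrite s2 mul0r add0r -pmulrn. Qed.

(** A square root of the discriminant. *)
Definition quad_delta : F := if (d %% 4 == 1)%N then s else 2 * s.

(** The choice (Delta + sqrt Delta) / 2 treats all residues of d modulo 4 at once. *)
Definition quad_omega : F := ((quad_disc d)%:R + quad_delta) / 2.

Let F2 : (2 : F) != 0.
Proof. by rewrite -[2]/(2%:R) -(rmorph_nat (in_alg F)) fmorph_eq0 pnatr_eq0. Qed.

Let F4 : (4 : F) != 0.
Proof. by rewrite (natrM _ 2 2) mulf_neq0. Qed.

Lemma quad_delta2 : quad_delta ^+ 2 = (quad_disc d)%:R.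
Proof.
rewrite /quad_delta /quad_disc; case: ifP => _ //.
by rewrite exprMn s2 natrM -natrX.
Qed.

Lemma squarefree_mod4 : (d %% 4)%N != 0%N.
Proof. by have := d_sqf (isT : prime 2); rewrite /dvdn. Qed.

Lemma quad_omega_is_int : quad_omega \in @is_int F.
Proof.
pose D := quad_disc d; pose e := (D * D.-1 %/ 4)%N.
have De : (D * D = D + 4 * e)%N.
  have : (4 %| D * D.-1)%N.
    rewrite /D /quad_disc; case: ifP => d4; last by rewrite dvdn_mulr // dvdn_mulr.
    by rewrite dvdn_mull // -subn1 -eqn_mod_dvd // ?(eqP d4) //; lia.
  by rewrite dvdn_eq -/e => /eqP; nia.
apply: (@integral_quadratic _ D%:Z (- e%:Z)).
rewrite -pmulrn rmorphN /= -pmulrn /quad_omega -/D.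
have := quad_delta2; rewrite -/D => d2.
have eF : D%:R * D%:R = D%:R + 4 * e%:R :> F by rewrite -natrM De natrD natrM.
have -> : (e%:R : F) = (D%:R * D%:R - D%:R) / 4.
  by rewrite eF addrC addKr mulrC mulKf ?F4.
by field: d2; rewrite F4 F2.
Qed.

(** With P the trace and N the norm of (P + Q * s) / 2, integrality is a condition
    on parities: P and Q have the same parity when d = 1 mod 4, and both are even
    when d = 2 or 3 mod 4, squares being 0 or 1 mod 4. *)
Lemma quad_parity (P Q N : int) : P ^+ 2 - d%:Z * Q ^+ 2 = 4 * N ->
  exists a b : int, P = 2 * a + (quad_disc d)%:Z * b /\
    Q = if (d %% 4 == 1)%N then b else 2 * b.
Proof.
move=> PQ; have d4 := squarefree_mod4; rewrite /quad_disc.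
have parity (m : int) : exists k, m = 2 * k \/ m = 2 * k + 1.
  by exists (m %/ 2)%Z; lia.
have [p Pp] := parity P; have [q Qq] := parity Q.
have dE : d = (4 * (d %/ 4) + d %% 4)%N by lia.
have r_lt : (d %% 4 < 4)%N by rewrite ltn_mod.
move: (d %/ 4)%N (d %% 4)%N dE d4 r_lt => g r dE d4 r_lt; rewrite {}dE in PQ *.
have {PQ} [M PQ] : exists M : int, P ^+ 2 - r%:Z * Q ^+ 2 = 4 * M.
  by exists (N + g%:Z * Q ^+ 2); rewrite mulrDr -PQ PoszD PoszM; ring.
case: Pp PQ => ->; case: Qq => -> PQ.
- case: eqP => r1; last by exists (p - 2 * (4 * g + r)%N%:Z * q), q; split=> //; nia.
  by exists (p - (4 * g + r)%N%:Z * q), (2 * q); split=> //; nia.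
- case: r => [|[|[|[|r]]]] // in d4 r_lt PQ *; have := expr2 p; have := expr2 q; lia.
- case: r => [|[|[|[|r]]]] // in d4 r_lt PQ *; have := expr2 p; have := expr2 q; lia.
- have r1 : r = 1%N.
    case: r => [|[|[|[|r]]]] // in d4 r_lt PQ *; have := expr2 p; have := expr2 q; lia.
  rewrite r1 eqxx; exists (p - 4 * g%:Z * q - 2 * g%:Z - q), (2 * q + 1); split=> //.
  by rewrite PoszD PoszM; ring.
Qed.

(** The trace and the norm of an integer are integers; when d is squarefree, they
    force the coordinates on 1, s to be half-integers, and [quad_parity] decides
    which ones occur. *)
Lemma quad_is_int_coord (x : F) : x \in @is_int F ->
  exists a b : int, x = a%:~R + b%:~R * quad_omega.
Proof.
have [c xc] := quad_coord x; case: c xc => p q /= xpq xint.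
have [|tau tauE] := @quad_rmorphism F (in_alg F) (- s); first by rewrite sqrrN.
have /rat_is_int_intr/intrP[P Pp] : (2 * p)%:A \in @is_int F.
  have -> : (2 * p)%:A = x + tau x.
    by rewrite xpq tauE quad_coordE -[LHS]/(in_alg F _) rmorphM rmorph_nat; ring.
  exact: rpredD (rmorph_is_int tau xint).
have /rat_is_int_intr/intrP[N Nn] : (p ^+ 2 - d%:R * q ^+ 2)%:A \in @is_int F.
  have -> : (p ^+ 2 - d%:R * q ^+ 2)%:A = x * tau x.
    rewrite xpq tauE quad_coordE -[LHS]/(in_alg F _).
    by rewrite rmorphB rmorphXn rmorphM rmorphXn rmorph_nat -s2; ring.
  exact: rpredM (rmorph_is_int tau xint).
have /intrP[Q Qq] : 2 * q \is a Num.int.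
  apply: (squarefree_scaled_square_int d_sqf).
  have -> : d%:R * (2 * q) ^+ 2 = (2 * p) ^+ 2 - 4 * (p ^+ 2 - d%:R * q ^+ 2) by ring.
  by rewrite Pp Nn rpredB ?rpredX ?rpredM ?intr_int ?rpred_nat.
have PQ : P ^+ 2 - d%:Z * Q ^+ 2 = 4 * N.
  apply/(@intr_inj rat); rewrite !(rmorphB, rmorphM, rmorphXn) /= -Pp -Qq -Nn -pmulrn.
  by ring.
have [a [b [Pab Qb]]] := quad_parity PQ.
have x2 : 2 * x = P%:~R + Q%:~R * s.
  have iE m : in_alg F m%:~R = m%:~R by rewrite rmorph_int.
  rewrite xpq quad_coordE -!iE -Pp -Qq !rmorphM rmorph_nat; ring.
exists a, b; apply: (mulfI F2); rewrite x2 Pab /quad_omega.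
have -> : Q%:~R * s = b%:~R * quad_delta.
  by rewrite Qb /quad_delta; case: ifP => // _; rewrite rmorphM /=; ring.
rewrite rmorphD !rmorphM /= -!pmulrn; field; exact: F2.
Qed.

Lemma quad_denominator (x : F) :
  exists N : nat, (0 < N)%N /\ N%:R * x \in @is_int F.
Proof.
have [[p q] /= ->] := quad_coord x.
have denE (r : rat) : exists D : nat, exists n : int, (0 < D)%N /\ D%:R * r = n%:~R.
  exists `|denq r|%N, (numq r); split; first by rewrite absz_gt0 denq_neq0.
  by rewrite natr_absz gtr0_norm ?denq_gt0 // mulrC -numqE.
have [D [n [D_gt0 Dp]]] := denE p; have [D' [n' [D'_gt0 Dq]]] := denE q.
exists (D * D')%N; split; first by rewrite muln_gt0 D_gt0.
have -> : (D * D')%:R * (p%:A + q *: s) = D'%:R * n%:~R + D%:R * n'%:~R * s.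
  rewrite natrM quad_coordE -!(rmorph_int (in_alg F)) -Dp -Dq !rmorphM !rmorph_nat.
  by ring.
by rewrite rpredD ?rpredM ?rpred_nat ?rpred_int ?quad_gen_is_int.
Qed.

Lemma quad_real_embeddings (R : realType) :
  exists (s1 s2 : {rmorphism F -> R}) (tau : {rmorphism F -> F}),
  [/\ forall x, s2 (tau x) = s1 x, 0 < s1 quad_omega - s2 quad_omega,
      (s1 quad_omega - s2 quad_omega) ^+ 2 = (quad_disc d)%:R
    & forall f : {rmorphism F -> R}, f =1 s1 \/ f =1 s2].
Proof.
have d_gt0 : 0 < d%:R :> R by rewrite ltr0n; lia.
pose r : R := Num.sqrt d%:R.
have r_gt0 : 0 < r by rewrite sqrtr_gt0.
have r2 : r ^+ 2 = d%:R by rewrite sqr_sqrtr // ltW.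
have [f1 f1E] := @quad_rmorphism R ratr r r2.
have [|f2 f2E] := @quad_rmorphism R ratr (- r); first by rewrite sqrrN.
have [|tau tauE] := @quad_rmorphism F (in_alg F) (- s); first by rewrite sqrrN.
have sE : s = 0%:A + 1 *: s by rewrite scale0r add0r scale1r.
have f1s : f1 s = r by rewrite sE f1E rmorph0 rmorph1 add0r mul1r.
have f2s : f2 s = - r by rewrite sE f2E rmorph0 rmorph1 add0r mul1r.
have diff : f1 quad_omega - f2 quad_omega = f1 quad_delta.
  rewrite /quad_omega !fmorph_div !rmorphD /= !rmorph_nat.
  have -> : f2 quad_delta = - f1 quad_delta.
    by rewrite /quad_delta; case: ifP; rewrite ?rmorphM ?rmorph_nat f1s f2s ?mulrN.
  by field.
exists f1, f2, tau; split.
- move=> x; have [[p q] /= ->] := quad_coord x.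
  rewrite tauE f1E rmorphD rmorphM rmorphN f2s opprK /=.
  by rewrite !rmorphZ_num !rmorph1 !mulr1.
- rewrite diff /quad_delta; case: ifP; rewrite ?rmorphM ?rmorph_nat f1s //.
  by rewrite pmulr_rgt0.
- by rewrite diff -rmorphXn quad_delta2 rmorph_nat.
- move=> f; have : f s ^+ 2 == r ^+ 2 by rewrite r2 -rmorphXn s2 rmorph_nat.
  rewrite eqf_sqr => /orP[] /eqP fs; [left|right] => x; have [[p q] /= ->] := quad_coord x.
    by rewrite f1E rmorphD !rmorphZ_num fs rmorph1 mulr1.
  by rewrite f2E rmorphD !rmorphZ_num fs rmorph1 mulr1.
Qed.

End QuadraticField.

(** * Escalation of integral quadratic forms *)

(** ** A finite certificate *)

(** An orthogonal system is recorded by the list ns of its norms, newest first, and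
    N stands for their product.  If v has norm t and inner product c_i with the
    i-th vector, its projection off the system, multiplied by N, has norm N * r
    with r = N * t - sum_i (N / n_i) * c_i ^ 2.  Positivity bounds the c_i by
    Cauchy-Schwarz, and [residuals N t ns (N * t)] lists the possible r. *)
Fixpoint residuals (N t : nat) (ns : seq nat) (r : nat) : seq nat :=
  if ns is n :: ns' then
    flatten [seq (if (N %/ n * c ^ 2 <= r)%N
                  then residuals N t ns' (r - N %/ n * c ^ 2) else [::])
            | c <- [seq c <- iota 0 (n + t) | (c ^ 2 <= n * t)%N]]
  else [:: r].

(** A bound for the length of that multiple of the projection, when v has length at
    most 1 and the system consists of vectors of length at most m: positivity of the
    norms of v + u and v - u gives |c| <= (n + t) / 2. *)
Definition extension_size (N t m : nat) (ns : seq nat) : nat :=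
  (N + m * sumn [seq (n + t)./2 * (N %/ n) | n <- ns])%N.

Definition norm_prod (ns : seq nat) : nat := foldr muln 1%N ns.

(** An integer which the diagonal form with coefficients ns does not represent over
    the rationals: 3 by the form 1, 1 (obstructed at 3) and 5 by 1, 2 (at 5); then 7
    or 14 by the ternary forms that are rationally equivalent to 1, 1, 1 or 1, 1, 2
    (at 2), 6 by 1, 1, 3 (at 3), and for the forms starting with 1, 2 and ending with
    12, 20 and 14, the integers 10 (at 2), 10 (at 5) and 21 (at 7).  The lists not
    mentioned do not occur in the escalation. *)
Definition truant (ns : seq nat) : nat :=
  match ns with
  | [::] => 1
  | [:: _] => 2
  | [:: 1; 1] => 3
  | [:: 2; 1] => 5
  | [:: 3; 1; 1] => 6
  | [:: 1; 1; 1] | [:: 2; 2; 1] | [:: 8; 2; 1] | [:: 18; 2; 1] => 7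
  | [:: 12; 2; 1] | [:: 20; 2; 1] => 10
  | [:: 2; 1; 1] | [:: 4; 2; 1] | [:: 16; 2; 1] => 14
  | [:: 14; 2; 1] => 21
  | _ => 0
  end.

(** Every choice of inner products leaves a vector of positive norm to adjoin, for k
    steps in a row, all lengths staying below M. *)
Fixpoint escalates (k M m : nat) (ns : seq nat) : bool :=
  if k is k'.+1 then
    let N := norm_prod ns in
    let t := truant ns in
    let m' := extension_size N t m ns in
    [&& (0 < t <= 21)%N, (maxn m.+1 m' <= M)%N &
        all (fun r => (0 < r)%N && escalates k' M (maxn m m') (N * r :: ns)%N)
            (residuals N t ns (N * t))]
  else true.

Lemma escalates4 : escalates 4 (10 ^ 4) 0 [::].
Proof. by vm_compute. Qed.

Lemma mem_residuals (T : eqType) (f c : T -> nat) (s : seq T) (N t r r0 : nat) :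
  {in s, forall x, (0 < f x)%N && (c x ^ 2 <= f x * t)%N} ->
  r0 = (r + \sum_(x <- s) N %/ f x * c x ^ 2)%N ->
  r \in residuals N t [seq f x | x <- s] r0.
Proof.
elim: s r0 => [|x s IHs] r0 hs ->.
  by rewrite big_nil addn0 mem_head.
have /andP[fx_gt0 cx_le] := hs x (mem_head _ _).
rewrite big_cons /=; apply/flatten_mapP; exists (c x).
  by rewrite mem_filter cx_le mem_iota /= add0n; nia.
rewrite ifT; last by lia.
apply: IHs => [y ys|]; first by apply: hs; rewrite inE ys orbT.
by lia.
Qed.

(** ** Gram-Schmidt steps *)

Section Escalation.

Variables (V : zmodType) (b : V -> V -> int).
Variables (S : nat -> V -> Prop) (M : nat).

Hypothesis bC : forall x y, b x y = b y x.
Hypothesis bDl : forall x y z, b (x + y) z = b x z + b y z.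
Hypothesis S0 : S 0 0.
Hypothesis SD : forall m n x y, S m x -> S n y -> S (m + n) (x + y).
Hypothesis SN : forall m x, S m x -> S m (- x).
Hypothesis Smono : forall m n x, (m <= n)%N -> S m x -> S n x.
Hypothesis b_ge0 : forall x, S M x -> 0 <= b x x.
Hypothesis b_repr :
  forall t : nat, (0 < t <= 21)%N -> exists2 v, S 1 v & b v v = t%:Z.

Let b0l z : b 0 z = 0.
Proof. by apply/(addrI (b 0 z)); rewrite -bDl !addr0. Qed.

Let bNl x z : b (- x) z = - b x z.
Proof. by apply/(addrI (b x z)); rewrite -bDl !subrr b0l. Qed.

Let bMzl x z k : b (x *~ k) z = b x z * k.
Proof.
have bMn n : b (x *+ n) z = b x z * n%:Z.
  elim: n => [|n IHn]; first by rewrite mulr0n b0l mulr0.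
  by rewrite mulrSr bDl IHn; lia.
case: k => n; first by rewrite -pmulrn bMn.
by rewrite NegzE mulrNz bNl -pmulrn bMn mulrN.
Qed.

Let b_suml (T : eqType) (s : seq T) (g : T -> V) z :
  b (\sum_(i <- s) g i) z = \sum_(i <- s) b (g i) z.
Proof. by elim: s => [|i s IHs]; rewrite ?big_nil ?b0l // !big_cons bDl IHs. Qed.

Let SMz m x k : S m x -> S (`|k| * m) (x *~ k).
Proof.
move=> Sx; have SMn n : S (n * m) (x *+ n).
  elim: n => [|n IHn]; first by rewrite mulr0n mul0n.
  by rewrite mulrS mulSn; apply: SD.
by case: k => n; [rewrite -pmulrn|rewrite NegzE mulrNz -pmulrn; apply: SN].
Qed.

Let S_sum (T : eqType) (s : seq T) (g : T -> V) (h : T -> nat) :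
  {in s, forall i, S (h i) (g i)} -> S (\sum_(i <- s) h i) (\sum_(i <- s) g i).
Proof.
elim: s => [|i s IHs] hs; rewrite ?big_nil // !big_cons.
apply: SD; first by apply: hs; rewrite mem_head.
by apply: IHs => j js; apply: hs; rewrite inE js orbT.
Qed.

Definition norms (us : seq V) : seq nat := [seq `|b u u|%N | u <- us].

Definition orthogonal_system (us : seq V) : bool :=
  pairwise (fun x y => b x y == 0) us && all (fun x => 0 < b x x) us.

Lemma orthogonal_consE w us : {in us, forall u, b w u = 0} -> 0 < b w w ->
  orthogonal_system us -> orthogonal_system (w :: us).
Proof.
move=> wus w_gt0 /andP[pw pos]; rewrite /orthogonal_system /= w_gt0 pw pos !andbT.
by apply/allP => u us_u; rewrite wus.
Qed.

Lemma orthogonal_system_uniq us : orthogonal_system us -> uniq us.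
Proof.
elim: us => //= x us IHus /andP[/= /andP[xo pw] /andP[xp pos]].
rewrite IHus ?andbT /orthogonal_system ?pw ?pos //.
by apply/negP => /(allP xo); rewrite gt_eqF.
Qed.

Lemma orthogonal_systemP us :
  orthogonal_system us ->
  {in us & us, forall x y, b x y = if x == y then `|b x x|%N : int else 0}.
Proof.
elim: us => // u us IHus /andP[/= /andP[/allP uo pw] /andP[up pos]] x y.
have {}IHus : {in us & us, forall x y, b x y = if x == y then `|b x x|%N : int else 0}.
  by apply: IHus; rewrite /orthogonal_system pw.
have uu : b u u = `|b u u|%N by lia.
rewrite !inE => /predU1P[->|xus] /predU1P[->|yus].
- by rewrite eqxx.
- rewrite (eqP (uo _ yus)); case: eqP => // uy; move: up.
  by rewrite {2}uy (eqP (uo _ yus)).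
- rewrite bC (eqP (uo _ xus)); case: eqP => // uy; move: up.
  by rewrite -{2}uy (eqP (uo _ xus)).
- exact: IHus.
Qed.

Lemma dvdn_norm_prod u us : u \in us -> (`|b u u| %| norm_prod (norms us))%N.
Proof.
elim: us => // x us IHus; rewrite inE => /predU1P[->|/IHus] /=.
  exact: dvdn_mulr.
exact: dvdn_mull.
Qed.

(** One Gram-Schmidt step: w is N times the component of v orthogonal to us.  The
    size bound is what makes b w w >= 0 available, and Cauchy-Schwarz for v and the
    vectors of us follows from that. *)
Lemma orthogonal_extension us m t v (ns := norms us) (N := norm_prod ns) :
  orthogonal_system us -> {in us, forall u, S m u} -> S 1 v -> b v v = t%:Z ->
  (maxn m.+1 (extension_size N t m ns) <= M)%N ->
  exists w r, [/\ r \in residuals N t ns (N * t), b w w = (N * r)%:Z,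
                  {in us, forall u, b w u = 0} & S (extension_size N t m ns) w].
Proof.
rewrite geq_max => ous Sus Sv vv /andP[mM m'M].
have gram := orthogonal_systemP ous.
have norm_gt0 u : u \in us -> (0 < `|b u u|)%N.
  by move=> uus; have /andP[_ /allP/(_ u uus)] := ous; lia.
have norm_dvd u : u \in us -> (N %/ `|b u u| * `|b u u|)%N = N.
  by move=> uus; rewrite divnK ?dvdn_norm_prod.
have c_le u : u \in us -> (`|b v u| <= (`|b u u| + t)./2)%N.
  move=> uus; have Su := Sus u uus.
  have S_M x : S (1 + m) x -> S M x by apply: Smono.
  have h1 := b_ge0 (S_M _ (SD Sv Su)).
  have h2 := b_ge0 (S_M _ (SD Sv (SN Su))).
  move: h1 h2; rewrite !(bDl, bNl) !(bC _ (_ + _)) !(bDl, bNl) vv (bC u v).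
  have := norm_gt0 u uus; have := gram u u uus uus; rewrite eqxx; lia.
pose g u := u *~ (b v u * (N %/ `|b u u|)%N%:Z).
pose w := v *~ N%:Z - \sum_(u <- us) g u.
have wus : {in us, forall u, b w u = 0}.
  move=> u uus; rewrite bDl bNl bMzl b_suml (bigD1_seq u) ?orthogonal_system_uniq //=.
  rewrite big_seq_cond big1 => [|x /andP[xus xu]]; last first.
    by rewrite bMzl (gram x u) // (negPf xu) mul0r.
  rewrite bMzl (gram u u) // eqxx addr0.
  by move: (norm_dvd u uus); set e := (N %/ _)%N => <-; rewrite PoszM; ring.
have ww : b w w = N%:Z * (N%:Z * t%:Z -
                 \sum_(u <- us) ((N %/ `|b u u|)%N * `|b v u| ^ 2)%N%:Z).
  rewrite -[LHS]/(b (v *~ N%:Z - \sum_(u <- us) g u) w) bDl bNl bMzl b_suml.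
  rewrite [X in _ - X]big_seq big1 ?subr0.
    rewrite mulrC bC /w bDl bNl bMzl b_suml vv; congr (_ * (_ - _)); first exact: mulrC.
    apply: eq_bigr => u _; rewrite bMzl (bC u v) PoszM; lia.
  by move=> u uus; rewrite bMzl bC wus // mul0r.
have Sw : S (extension_size N t m ns) w.
  apply: SD; first by have := SMz N%:Z Sv; rewrite muln1.
  apply: SN; apply: (@Smono (\sum_(u <- us) (`|b v u| * (N %/ `|b u u|) * m))%N).
    rewrite /ns /norms -map_comp sumnE big_map big_distrr /= !big_seq.
    apply: leq_sum => u uus; rewrite mulnC leq_mul2l.
    by rewrite leq_mul ?orbT ?c_le.
  by apply: S_sum => u uus; have := SMz (b v u * (N %/ `|b u u|)%N) (Sus u uus);
     rewrite abszM.
have N_gt0 : (0 < N)%N.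
  rewrite /N /ns; elim: (us) norm_gt0 => //= u s IHs h.
  rewrite muln_gt0 h ?mem_head // IHs // => x xs.
  by apply: h; rewrite inE xs orbT.
set q := (\sum_(u <- us) (N %/ `|b u u| * `|b v u| ^ 2))%N.
have q_le : (q <= N * t)%N.
  have := b_ge0 (Smono m'M Sw); rewrite ww -(big_morph _ PoszD (erefl _)) -/q.
  by rewrite pmulr_rge0 ?ltz_nat // subr_ge0 -PoszM lez_nat.
exists w, (N * t - q)%N; split=> //; last first.
  by rewrite ww -(big_morph _ PoszD (erefl _)) -/q PoszM -subzn // PoszM.
apply: (@mem_residuals _ _ (fun u => `|b v u|%N)); last by rewrite subnK.
move=> u uus; rewrite norm_gt0 //=.
have : (N %/ `|b u u| * `|b v u| ^ 2 <= N * t)%N.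
  apply: leq_trans q_le; rewrite /q (bigD1_seq u) ?orthogonal_system_uniq //=.
  exact: leq_addr.
have := norm_dvd u uus; have := norm_gt0 u uus; set n := `|b u u|%N.
move: (N %/ n)%N => e n_gt0 en; rewrite -en -mulnA leq_pmul2l //.
by case: e en => // en; lia.
Qed.

(** The certificate is consumed one vector at a time; representing the truant of the
    current system provides the vector to project. *)
Lemma orthogonal_escalation k m us :
  escalates k M m (norms us) -> (m <= M)%N -> orthogonal_system us ->
  {in us, forall u, S m u} ->
  exists ws, [/\ size ws = (size us + k)%N, orthogonal_system ws &
                 {in ws, forall w, S M w}].
Proof.
elim: k m us => [|k IHk] m us.
  move=> _ mM ous Sus; exists us; rewrite addn0; split=> // u /Sus.
  exact: Smono.
move=> /= /and3P[/b_repr[v Sv vv] size_le /allP esc] mM ous Sus.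
have [w [r [/esc/andP[r_gt0 {}esc] ww wus Sw]]] :=
  orthogonal_extension ous Sus Sv vv size_le.
move: size_le; rewrite geq_max => /andP[_ size_le].
have w_norm : `|b w w|%N = (norm_prod (norms us) * r)%N by rewrite ww.
have w_gt0 : 0 < b w w.
  rewrite ww ltz_nat muln_gt0 r_gt0 andbT.
  have /andP[_] := ous; elim: (us) => //= u s IHs /andP[u_gt0 /IHs].
  by rewrite muln_gt0 => ->; rewrite andbT; lia.
have esc' : escalates k M (maxn m (extension_size (norm_prod (norms us))
    (truant (norms us)) m (norms us))) (norms (w :: us)).
  by rewrite /= w_norm; exact: esc.
have [|||ws [sz ows Sws]] := IHk _ (w :: us) esc'.
- by rewrite geq_max mM.
- exact: orthogonal_consE.
- move=> u; rewrite inE => /predU1P[->|/Sus].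
    by apply: Smono Sw; exact: leq_maxr.
  by apply: Smono; exact: leq_maxl.
by exists ws; rewrite sz addSnnS.
Qed.

End Escalation.

(** * The bilinear form of a lattice *)

Section BilinearForm.

Variables (F : fieldExtType rat) (L : quad_lattice F).
Implicit Types x y z : L.

Lemma bil_formC x y : bil_form x y = bil_form y x.
Proof. by case: L x y. Qed.

Lemma bil_form_linl y : linear_for (@int_val F \; *%R) (fun x => bil_form x y).
Proof. by case: L y. Qed.

Lemma bil_formxx x : bil_form x x = int_val (quad_form x).
Proof. by case: L x. Qed.

Lemma bil_formDl x y z : bil_form (x + y) z = bil_form x z + bil_form y z.
Proof. by have := bil_form_linl z 1 x y; rewrite scale1r /= mul1r. Qed.

Lemma bil_form0l z : bil_form (0 : L) z = 0.
Proof. by apply/(addrI (bil_form (0 : L) z)); rewrite -bil_formDl !addr0. Qed.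

Lemma bil_formZl a x z : bil_form (a *: x) z = int_val a * bil_form x z.
Proof. by have := bil_form_linl z a x 0; rewrite addr0 /= bil_form0l addr0. Qed.

Lemma bil_formNl x z : bil_form (- x) z = - bil_form x z.
Proof. by apply/(addrI (bil_form x z)); rewrite -bil_formDl !subrr bil_form0l. Qed.

Lemma bil_form_suml (I : Type) (r : seq I) (f : I -> L) z :
  bil_form (\sum_(i <- r) f i) z = \sum_(i <- r) bil_form (f i) z.
Proof.
by elim: r => [|i r IHr]; rewrite ?big_nil ?bil_form0l // !big_cons bil_formDl IHr.
Qed.

Lemma bil_formMnl x z n : bil_form (x *+ n) z = bil_form x z *+ n.
Proof.
by elim: n => [|n IHn]; rewrite ?mulr0n ?bil_form0l // !mulrS bil_formDl IHn.
Qed.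

End BilinearForm.

(** * Short vectors in a universal lattice over a field of large discriminant *)

Section Lattice.

Variables (R : realType) (F : fieldExtType rat) (L : quad_lattice F).
Variables (omega : F) (s1 s2 : {rmorphism F -> R}) (tau : {rmorphism F -> F}).
Variables (coord : F -> int * int).

Hypothesis omega_int : omega \in @is_int F.
Hypothesis coordE : forall x, x \in @is_int F ->
  x = (coord x).1%:~R + (coord x).2%:~R * omega.
Hypothesis denominator : forall x : F, exists N : nat,
  (0 < N)%N /\ N%:R * x \in @is_int F.
Hypothesis tauE : forall x, s2 (tau x) = s1 x.
Hypothesis real_embedding : forall f : {rmorphism F -> R}, f =1 s1 \/ f =1 s2.

Local Notation delta := (s1 omega - s2 omega).
Hypothesis delta_large : 10 ^+ 12 < delta.

Hypothesis L_pos : positive_definite R L.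
Hypothesis L_classic : classic L.
Hypothesis L_univ : universal R L.

Implicit Types x y z v w : L.

Let delta_gt0 : 0 < delta.
Proof. by apply: le_lt_trans delta_large; rewrite exprn_ge0. Qed.

Lemma coord_unique a b a' b' :
  a%:~R + b%:~R * omega = a'%:~R + b'%:~R * omega -> a = a' /\ b = b'.
Proof.
move=> e; have f_e (f : {rmorphism F -> R}) :
    a%:~R + b%:~R * f omega = a'%:~R + b'%:~R * f omega.
  by have := congr1 f e; rewrite !(rmorphD, rmorphM) /= !rmorph_int.
have bb : b = b'.
  apply/(@intr_inj R)/(mulIf (lt0r_neq0 delta_gt0)).
  have := f_e s1; have := f_e s2; lra.
by split=> //; have := f_e s1; rewrite bb => /addIr/intr_inj.
Qed.

(** The coordinates of the bilinear form on 1, omega.  They are symmetric and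
    biadditive, and the hypotheses of the escalation hold for both. *)
Definition rat_part x y : int := (coord (bil_form x y)).1.
Definition irr_part x y : int := (coord (bil_form x y)).2.

Lemma bil_formE x y :
  bil_form x y = (rat_part x y)%:~R + (irr_part x y)%:~R * omega.
Proof. exact/coordE/L_classic. Qed.

Lemma partE x y a b : bil_form x y = a%:~R + b%:~R * omega ->
  rat_part x y = a /\ irr_part x y = b.
Proof. by rewrite bil_formE => /coord_unique. Qed.

Lemma partC x y : rat_part x y = rat_part y x /\ irr_part x y = irr_part y x.
Proof. by apply: partE; rewrite bil_formC bil_formE. Qed.

Lemma partDl x y z :
  rat_part (x + y) z = rat_part x z + rat_part y z /\
  irr_part (x + y) z = irr_part x z + irr_part y z.
Proof. by apply: partE; rewrite bil_formDl !bil_formE !rmorphD /=; ring. Qed.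

Let rat_partC x y := (partC x y).1.
Let irr_partC x y := (partC x y).2.
Let rat_partDl x y z := (partDl x y z).1.
Let irr_partDl x y z := (partDl x y z).2.

Lemma rat_part0l z : rat_part 0 z = 0.
Proof. by have := rat_partDl 0 0 z; rewrite addr0; lia. Qed.

Lemma irr_part0l z : irr_part 0 z = 0.
Proof. by have := irr_partDl 0 0 z; rewrite addr0; lia. Qed.

Lemma irr_partNl x z : irr_part (- x) z = - irr_part x z.
Proof. by have := irr_partDl x (- x) z; rewrite subrr irr_part0l; lia. Qed.

Lemma irr_partDD x y :
  irr_part (x + y) (x + y) = irr_part x x + 2 * irr_part x y + irr_part y y.
Proof.
by rewrite irr_partDl !(irr_partC _ (x + y)) !irr_partDl (irr_partC y x); ring.
Qed.

Lemma irr_partMnl x z n : irr_part (x *+ n) z = irr_part x z *+ n.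
Proof.
by elim: n => [|n IHn]; rewrite ?mulr0n ?irr_part0l // !mulrS irr_partDl IHn.
Qed.

Lemma embedding_diff x y :
  s1 (bil_form x y) - s2 (bil_form x y) = (irr_part x y)%:~R * delta.
Proof. by rewrite bil_formE !rmorphD !rmorphM /= !rmorph_int; ring. Qed.

Section Size.

Variable f : {rmorphism F -> R}.

Definition fform x y : R := f (bil_form x y).

Lemma fform_gt0 x : x <> 0 -> 0 < fform x x.
Proof. by move=> x0; rewrite /fform bil_formxx; apply: L_pos. Qed.

Lemma fform_ge0 x : 0 <= fform x x.
Proof.
have [->|/eqP/fform_gt0/ltW //] := eqVneq x 0.
by rewrite /fform bil_form0l rmorph0.
Qed.

Lemma fformC x y : fform x y = fform y x.
Proof. by rewrite /fform bil_formC. Qed.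

Lemma fformN x y : fform (- x) y = - fform x y.
Proof. by rewrite /fform bil_formNl rmorphN. Qed.

Lemma fformNN x : fform (- x) (- x) = fform x x.
Proof. by rewrite fformN fformC fformN opprK. Qed.

Lemma fformMn x y n : fform (x *+ n) y = n%:R * fform x y.
Proof. by rewrite /fform bil_formMnl rmorphMn /= mulr_natl. Qed.

(** The square root of [fform x x / 21] is a norm, and m bounds it.  The factor 21 lets
    the integers up to 21 count as values of vectors of length at most 1. *)
Definition size_le (m : nat) x : Prop := fform x x <= 21 * m%:R ^+ 2.

Lemma size_le_mono m n x : (m <= n)%N -> size_le m x -> size_le n x.
Proof.
move=> mn /le_trans; apply; rewrite ler_pM2l ?ltr0n //.
by rewrite lerXn2r ?nnegrE ?ler0n ?ler_nat.
Qed.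

Lemma size_le0 : size_le 0 0.
Proof. by rewrite /size_le /fform bil_form0l rmorph0 expr0n mulr0. Qed.

Lemma size_leN m x : size_le m x -> size_le m (- x).
Proof.
by rewrite /size_le fformNN.
Qed.

Lemma fformDD x y : fform (x + y) (x + y) = fform x x + 2 * fform x y + fform y y.
Proof.
rewrite /fform bil_formDl !(bil_formC _ (x + y)) !bil_formDl (bil_formC y x).
by rewrite !rmorphD; ring.
Qed.

(** The triangle inequality; as in Cauchy-Schwarz, it comes from the positivity of
    the form at n x - m y. *)
Lemma size_leD m n x y : size_le m x -> size_le n y -> size_le (m + n) (x + y).
Proof.
have small0 z : size_le 0 z -> z = 0.
  rewrite /size_le expr0n mulr0 => z0; apply/eqP; apply: contraT => /eqP/fform_gt0.
  by rewrite ltNge z0.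
case: m => [/small0 -> sy|m sx]; first by rewrite !add0r.
case: n => [/small0 ->|n sy]; first by rewrite addr0 addn0.
have : 0 <= fform (x *+ n.+1 - y *+ m.+1) (x *+ n.+1 - y *+ m.+1) by exact: fform_ge0.
rewrite fformDD; move: sx sy; rewrite /size_le fformDD natrD.
have -> : fform (x *+ n.+1) (- (y *+ m.+1)) = - (m.+1%:R * n.+1%:R * fform x y).
  by rewrite fformC fformN fformMn fformC fformMn mulrA.
have sqr z k : fform (z *+ k) (z *+ k) = k%:R ^+ 2 * fform z z.
  by rewrite fformMn fformC fformMn mulrA.
rewrite fformNN !sqr.
have : 0 < m.+1%:R :> R by rewrite ltr0n.
have : 0 < n.+1%:R :> R by rewrite ltr0n.
move: m.+1%:R n.+1%:R (fform x x) (fform y y) (fform x y) => a b q q' c b0 a0 qa qb h.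
suff : c <= 21 * (a * b) by lra.
have ab0 : 0 < a * b by rewrite mulr_gt0.
rewrite -(ler_pM2l ab0).
have h1 : b ^+ 2 * q <= b ^+ 2 * (21 * a ^+ 2) by rewrite ler_pM2l // exprn_gt0.
have h2 : a ^+ 2 * q' <= a ^+ 2 * (21 * b ^+ 2) by rewrite ler_pM2l // exprn_gt0.
lra.
Qed.

Lemma size_leMn m n x : size_le m x -> size_le (n * m) (x *+ n).
Proof.
rewrite /size_le => x_le; rewrite fformMn fformC fformMn mulrA -expr2 natrM.
by rewrite exprMn mulrCA ler_wpM2l // exprn_ge0.
Qed.

End Size.

(** The escalation stays below this length.  Vectors of this length get combined
    later, with coefficients up to 11, and lengths up to 20 times this bound still
    have values below sqrt Delta: 21 * (2 * 10^5)^2 < 10^12. *)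
Definition max_size : nat := (10 ^ 4)%N.

Lemma fform_lt_delta f m x :
  (m <= 20 * max_size)%N -> size_le f m x -> fform f x x < delta.
Proof.
move=> m_le /le_lt_trans; apply; apply: le_lt_trans delta_large.
have : m%:R <= 20 * 10 ^+ 4 :> R.
  by move: m_le; rewrite -(ler_nat R) natrM /max_size natrX.
have := ler0n R m; move: (m%:R) => a; nra.
Qed.

(** As s1 Q is nonnegative and s2 Q is less than delta, their difference b * delta
    exceeds - delta. *)
Lemma irr_part_ge0 m x :
  (m <= 20 * max_size)%N -> size_le s2 m x -> 0 <= irr_part x x.
Proof.
move=> m_le /(fform_lt_delta m_le) q2_lt.
have := embedding_diff x x; have := fform_ge0 s1 x.
rewrite -!/(fform _ x x) => q1_ge0 diff; suff : -1 < irr_part x x by lia.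
rewrite -(ltr_int R) -(ltr_pM2r delta_gt0) -diff; lra.
Qed.

Definition small m x : Prop := size_le s1 m x /\ size_le s2 m x.

(** Here b * delta is the difference of two numbers in [0, delta[. *)
Lemma small_irr_part0 m x : (m <= 20 * max_size)%N -> small m x -> irr_part x x = 0.
Proof.
move=> m_le [q1_le q2_le]; have := irr_part_ge0 m_le q2_le.
have := fform_lt_delta m_le q1_le; have := fform_ge0 s2 x.
have := embedding_diff x x; rewrite -!/(fform _ x x) => diff q2_ge0 q1_lt.
suff : irr_part x x < 1 by lia.
rewrite -(ltr_int R) -(ltr_pM2r delta_gt0) -diff; lra.
Qed.

(** The norm b vanishes at x, at y and at x + y, which is still short. *)
Lemma small_irr_part_orthogonal x y :
  small max_size x -> small max_size y -> irr_part x y = 0.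
Proof.
have le1 : (max_size <= 20 * max_size)%N by rewrite leq_pmull.
have le2 : (max_size + max_size <= 20 * max_size)%N.
  by rewrite addnn -mul2n leq_mul2r orbT.
move=> sx sy; have x0 := small_irr_part0 le1 sx; have y0 := small_irr_part0 le1 sy.
have : irr_part (x + y) (x + y) = 0.
  by apply: small_irr_part0 le2 _; case: sx sy => ? ? [? ?]; split; apply: size_leD.
by rewrite irr_partDD x0 y0; lia.
Qed.

Lemma small_rat_part_ge0 x : small max_size x -> 0 <= rat_part x x.
Proof.
move=> sx; have := fform_ge0 s1 x; rewrite /fform bil_formE small_irr_part_orthogonal //.
by rewrite mul0r addr0 rmorph_int ler0z.
Qed.

Lemma totally_positive_represented (a b : int) :
  0 < a%:~R + b%:~R * s1 omega -> 0 < a%:~R + b%:~R * s2 omega ->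
  exists x, bil_form x x = a%:~R + b%:~R * omega.
Proof.
move=> pos1 pos2; have z_int : a%:~R + b%:~R * omega \in @is_int F.
  by rewrite rpredD ?rpredM ?rpred_int.
have sE (f : {rmorphism F -> R}) :
    f (a%:~R + b%:~R * omega) = a%:~R + b%:~R * f omega.
  by rewrite rmorphD rmorphM /= !rmorph_int.
have [|x xz] := (L_univ (IntRing z_int)).2.
  by left=> f /=; rewrite sE; case: (real_embedding f) => ->.
by exists x; rewrite bil_formxx xz.
Qed.

Lemma rat_part_represents (t : nat) : (0 < t <= 21)%N ->
  exists2 w, small 1 w & rat_part w w = t%:Z.
Proof.
move=> /andP[t_gt0 t_le]; have [||w wt] := @totally_positive_represented t%:Z 0.
- by rewrite mul0r addr0 ltr0z.
- by rewrite mul0r addr0 ltr0z.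
exists w; last by have [] := partE wt.
by split; rewrite /size_le /fform wt rmorphD rmorphM /= !rmorph_int mul0r addr0
  expr1n mulr1 -pmulrn ler_nat.
Qed.

(** Orthogonality to the vectors that are short under both embeddings is recorded
    together with the length: the norm of a vector built by the escalation may be too
    large to deduce it from positivity afterwards. *)
Definition small_irr_form m x : Prop :=
  size_le s2 m x /\ forall w, small max_size w -> irr_part x w = 0.

(** The vector v represents the element a + t * omega whose image under s2 lies in
    ]0, 1].  If w is short under both embeddings, then b w w = 0, and positivity of
    the norm t +- 2 * 11 * b v w of v +- 11 w forces b v w = 0, as t < 22. *)
Lemma irr_part_represents (t : nat) : (0 < t <= 21)%N ->
  exists2 v, small_irr_form 1 v & irr_part v v = t%:Z.
Proof.
move=> /andP[t_gt0 t_le]; pose a := Num.floor (- (t%:R * s2 omega)) + 1.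
have [a_gt a_le] : 0 < a%:~R + t%:Z%:~R * s2 omega /\ a%:~R + t%:Z%:~R * s2 omega <= 1.
  have := floor_itv (- (t%:R * s2 omega)); rewrite /a -pmulrn.
  rewrite !rmorphD /= !rmorph1; lra.
have [|//|v vt] := @totally_positive_represented a t%:Z.
  apply: lt_le_trans a_gt _; rewrite lerD2l ler_pM2l ?ltr0z //.
  by rewrite -subr_ge0 ltW.
have irr_v : irr_part v v = t by have [] := partE vt.
have size_v : size_le s2 1 v.
  rewrite /size_le /fform vt rmorphD rmorphM /= !rmorph_int expr1n mulr1.
  by apply: le_trans a_le _; rewrite ler1n.
exists v => //; split=> // w sw.
have w0 : irr_part w w = 0 by exact: small_irr_part_orthogonal.
have size_w : size_le s2 (11 * max_size) (w *+ 11) by case: sw => _; exact: size_leMn.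
have h (z : L) : size_le s2 (11 * max_size) z -> 0 <= irr_part (v + z) (v + z).
  move=> sz; apply: (@irr_part_ge0 (1 + 11 * max_size)); last exact: size_leD.
  by rewrite /max_size; lia.
have := h _ size_w; have := h _ (size_leN size_w).
have vz : irr_part v (w *+ 11) = 11 * irr_part v w.
  by rewrite irr_partC irr_partMnl irr_partC; lia.
have zz : irr_part (w *+ 11) (w *+ 11) = 0.
  by rewrite irr_partMnl irr_partC irr_partMnl w0 !mul0rn.
have vNz : irr_part v (- (w *+ 11)) = - irr_part v (w *+ 11).
  by rewrite irr_partC irr_partNl irr_partC.
have NzNz : irr_part (- (w *+ 11)) (- (w *+ 11)) = 0.
  by rewrite irr_partNl irr_partC irr_partNl zz.
rewrite (irr_partDD v (w *+ 11)) (irr_partDD v (- (w *+ 11))) vNz NzNz vz zz irr_v; lia.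
Qed.

Lemma common_denominator (I : finType) (k : I -> F) :
  exists N : nat, (0 < N)%N /\ forall i, N%:R * k i \in @is_int F.
Proof.
have [N N_k] : exists N : I -> nat,
    forall i, (0 < N i)%N /\ (N i)%:R * k i \in @is_int F.
  by have [N N_k] := boolp.choice (fun i => denominator (k i)); exists N.
exists (\prod_i N i)%N; split; first by rewrite prodn_gt0 // => i; have [] := N_k i.
move=> i; rewrite (bigD1 i) //= mulnC natrM -mulrA rpredM ?rpred_nat //.
by have [] := N_k i.
Qed.

(** The combination z of the u i has the conjugates of the coefficients of the
    relation.  Under s2 these become the images of the coefficients under s1, so that
    the relation can be used in s2 (Q z), up to the difference delta * b between the
    two images of the Gram matrix. *)
Lemma orthogonal_independent (I : finType) (u : I -> L) (k : I -> F) :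
  (forall i, u i <> 0) -> (forall i, 0 <= irr_part (u i) (u i)) ->
  (forall i j, i != j -> irr_part (u i) (u j) = 0) ->
  (forall i j, i != j -> irr_part (u i) (u i) = 0 -> irr_part (u j) (u j) = 0 ->
    bil_form (u i) (u j) = 0) ->
  (forall y, \sum_i k i * bil_form (u i) y = 0) -> forall i, k i = 0.
Proof.
move=> u_neq0 irr_ge0 irr_orth rat_orth rel.
have [N [N_gt0 Nk_int]] := common_denominator k.
have NF : N%:R != 0 :> F.
  by rewrite -(rmorph_nat (in_alg F)) fmorph_eq0 pnatr_eq0 -lt0n.
pose c i := N%:R * k i.
suff c0 : forall i, c i = 0.
  by move=> i; apply/eqP; have /eqP := c0 i; rewrite mulf_eq0 (negPf NF).
have {}rel y : \sum_i c i * bil_form (u i) y = 0.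
  by under eq_bigr do rewrite -mulrA; rewrite -big_distrr /= rel mulr0.
(* Conjugates of integers are integers, so z lies in L and not only in its span. *)
pose a i : int_ring F := IntRing (rmorph_is_int tau (Nk_int i)).
have s2a i : s2 (int_val (a i)) = s1 (c i) by exact: tauE.
pose z := \sum_i a i *: u i.
have q2z : fform s2 z z = - (delta * \sum_i (irr_part (u i) (u i))%:~R * s1 (c i) ^+ 2).
  have -> : fform s2 z z =
      \sum_i \sum_j s1 (c i) * s1 (c j) * fform s2 (u i) (u j).
    rewrite /fform /z bil_form_suml rmorph_sum; apply: eq_bigr => i _ /=.
    rewrite bil_formZl bil_formC bil_form_suml big_distrr rmorph_sum.
    apply: eq_bigr => j _ /=.
    rewrite bil_formZl (rmorphM s2 (int_val (a i))) (rmorphM s2 (int_val (a j))) !s2a.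
    by rewrite bil_formC mulrA.
  have -> : \sum_i \sum_j s1 (c i) * s1 (c j) * fform s2 (u i) (u j) =
      \sum_i s1 (c i) * s1 (\sum_j c j * bil_form (u j) (u i)) -
      \sum_i \sum_j s1 (c i) * s1 (c j) * ((irr_part (u i) (u j))%:~R * delta).
    rewrite -sumrB; apply: eq_bigr => i _.
    rewrite rmorph_sum big_distrr -sumrB; apply: eq_bigr => j _.
    rewrite /= -embedding_diff rmorphM (bil_formC (u j)) /fform; ring.
  rewrite big1 => [|i _]; last by rewrite rel rmorph0 mulr0.
  rewrite sub0r big_distrr; congr (- _); apply: eq_bigr => i _ /=.
  rewrite (bigD1 i) //= big1 => [|j ji]; last by rewrite irr_orth 1?eq_sym // mul0r mulr0.
  by ring.
have sum0 : \sum_i (irr_part (u i) (u i))%:~R * s1 (c i) ^+ 2 <= 0.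
  by have := fform_ge0 s2 z; rewrite q2z oppr_ge0 pmulr_rle0.
(* A sum of nonnegative terms that is at most 0. *)
have irr_c0 i : irr_part (u i) (u i) != 0 -> c i = 0.
  move=> irr0; apply: (fmorph_inj s1); rewrite rmorph0.
  have : (irr_part (u i) (u i))%:~R * s1 (c i) ^+ 2 = 0.
    have term_ge0 j : 0 <= (irr_part (u j) (u j))%:~R * s1 (c j) ^+ 2.
      by rewrite mulr_ge0 ?ler0z ?sqr_ge0.
    apply/eqP; rewrite eq_le term_ge0 andbT; apply: le_trans sum0.
    by rewrite (bigD1 i) //= lerDl sumr_ge0.
  by move/eqP; rewrite mulf_eq0 intr_eq0 (negPf irr0) expf_eq0 /= => /eqP.
move=> i; have [irr0|/irr_c0 //] := eqVneq (irr_part (u i) (u i)) 0.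
have := rel (u i); rewrite (bigD1 i) //= big1 => [|j ji].
  move/eqP; rewrite addr0 mulf_eq0 => /orP[/eqP //|].
  have := fform_gt0 s1 (u_neq0 i); rewrite /fform => /[swap] /eqP ->.
  by rewrite rmorph0 ltxx.
have [irrj|/irr_c0 ->] := eqVneq (irr_part (u j) (u j)) 0; last by rewrite mul0r.
by rewrite rat_orth ?mulr0.
Qed.

(** The last clause compares norms to zero in order to single out the four vectors
    coming from the form p, for which b vanishes and orthogonality for p is
    orthogonality in L. *)
Lemma orthogonal_family8 : exists us : seq L,
  [/\ size us = 8, {in us, forall x, x <> 0 /\ 0 <= irr_part x x}
    & pairwise (fun x y => (irr_part x y == 0) &&
        ((irr_part x x == 0) && (irr_part y y == 0) ==> (bil_form x y == 0))) us].
Proof.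
have le1 : (max_size <= 20 * max_size)%N by rewrite leq_pmull.
have [ws [ws4 /andP[ws_orth /allP ws_pos] ws_small]] :
    exists ws, [/\ size ws = 4, orthogonal_system rat_part ws
                 & {in ws, forall w, small max_size w}].
  apply: (@orthogonal_escalation _ rat_part small max_size rat_partC rat_partDl
    _ _ _ _ _ _ 4 0 [::] escalates4 (leq0n _) isT).
  - by split; exact: size_le0.
  - by move=> m n x y [? ?] [? ?]; split; exact: size_leD.
  - by move=> m x [? ?]; split; exact: size_leN.
  - by move=> m n x mn [? ?]; split; exact: size_le_mono mn _.
  - exact: small_rat_part_ge0.
  - exact: rat_part_represents.
  - by [].
have [vs [vs4 /andP[vs_orth /allP vs_pos] vs_small]] :
    exists vs, [/\ size vs = 4, orthogonal_system irr_part vs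
                 & {in vs, forall v, small_irr_form max_size v}].
  apply: (@orthogonal_escalation _ irr_part small_irr_form max_size irr_partC irr_partDl
    _ _ _ _ _ _ 4 0 [::] escalates4 (leq0n _) isT).
  - by split; [exact: size_le0|move=> w _; rewrite irr_part0l].
  - move=> m n x y [sx xo] [sy yo]; split; first exact: size_leD.
    by move=> w sw; rewrite irr_partDl xo ?yo.
  - move=> m x [sx xo]; split; first exact: size_leN.
    by move=> w sw; rewrite irr_partNl xo.
  - by move=> m n x mn [sx xo]; split=> //; exact: size_le_mono mn _.
  - by move=> x [sx _]; exact: irr_part_ge0 sx.
  - exact: irr_part_represents.
  - by [].
have w_irr0 w w' : w \in ws -> w' \in ws -> irr_part w w' = 0.
  by move=> /ws_small sw /ws_small; exact: small_irr_part_orthogonal.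
have vw_irr0 v w : v \in vs -> w \in ws -> irr_part v w = 0.
  by move=> /vs_small[_ vo] /ws_small; exact: vo.
exists (ws ++ vs); split; first by rewrite size_cat ws4 vs4.
- move=> x; rewrite mem_cat => /orP[xw|xv]; split.
  + by move=> x0; have := ws_pos _ xw; rewrite x0 rat_part0l.
  + by rewrite w_irr0.
  + by move=> x0; have := vs_pos _ xv; rewrite x0 irr_part0l.
  + exact/ltW/vs_pos.
- rewrite pairwise_cat; apply/and3P; split.
  + apply/allrelP => w v wws vvs; rewrite irr_partC vw_irr0 //=.
    by rewrite (gt_eqF (vs_pos _ vvs)) andbF.
  + apply: (@sub_in_pairwise _ (mem ws) _ _ _ ws _ ws_orth); last exact/allP.
    move=> w w' wws w'ws /eqP rat0 /=; rewrite w_irr0 // eqxx /=; apply/implyP => _.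
    by rewrite bil_formE rat0 w_irr0 // mul0r addr0.
  + apply: (@sub_in_pairwise _ (mem vs) _ _ _ vs _ vs_orth); last exact/allP.
    move=> v v' vvs v'vs /eqP vv' /=; rewrite vv' eqxx /=.
    by rewrite (gt_eqF (vs_pos _ vvs)).
Qed.

(** By the universal property of the extension of scalars, the form B(-, y) extends to
    V, so that a relation in V is a relation between the rows of the Gram matrix. *)
Lemma rank_ge8 n : has_rank L n -> (8 <= n)%N.
Proof.
move=> [V [iota [[_ ext] dimV]]]; have [us [us8 us_pos us_orth]] := orthogonal_family8.
pose u (i : 'I_8) := us`_i.
have u_in i : u i \in us by rewrite mem_nth // us8.
pose X := [tuple iota (u i) | i < 8].
suff : free X.
  rewrite /free => /eqP dimX; have := dimvS (subvf <<X>>%VS).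
  by rewrite dimX size_tuple dimV.
apply/freeP => k rel.
have u_orth i j : i != j -> irr_part (u i) (u j) = 0 /\
    (irr_part (u i) (u i) = 0 -> irr_part (u j) (u j) = 0 -> bil_form (u i) (u j) = 0).
  have orth_lt (i' j' : 'I_8) : (i' < j')%N -> irr_part (u i') (u j') = 0 /\
    (irr_part (u i') (u i') = 0 -> irr_part (u j') (u j') = 0 -> bil_form (u i') (u j') = 0).
    move=> ij; have /pairwiseP := us_orth; move=> /(_ 0) /(_ i' j').
    rewrite !inE us8 => /(_ (ltn_ord _) (ltn_ord _) ij) /andP[/eqP-> /implyP h].
    by split=> // i0 j0; apply/eqP/h; rewrite i0 j0.
  rewrite neq_ltn => /orP[/orth_lt //|/orth_lt[irr0 h]].
  by rewrite irr_partC bil_formC; split=> // i0 j0; exact: h.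
apply: (@orthogonal_independent _ u).
- by move=> i; case: (us_pos _ (u_in i)).
- by move=> i; case: (us_pos _ (u_in i)).
- by move=> i j /u_orth[].
- by move=> i j /u_orth[].
move=> y; have [g [gE _]] := ext F^o (fun x => bil_form x y) (bil_form_linl y).
have := congr1 g rel; rewrite linear_sum linear0 => gX; rewrite -[RHS]gX.
by apply: eq_bigr => i _; rewrite linearZ /= (nth_map i) ?size_enum_ord // gE nth_ord_enum.
Qed.

End Lattice.

Theorem theorem3p1 (R : realType) (d : nat) (F : fieldExtType rat)
    (d_gt1 : (1 < d)%N) (d_sqf : squarefree d) (hF : is_quadratic_field d F)
    (hdisc : ((29 * 10 ^ 12 + 524 * 10 ^ 9 + 500 * 10 ^ 6 + 5) ^ 2
              < quad_disc d)%N) :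
  ~ exists L : quad_lattice F,
      [/\ positive_definite R L, classic L, universal R L & has_rank L 7].
Proof.
move=> [L [L_pos L_classic L_univ L_rank]].
have [s [s2 Fs]] := hF.
have [f1 [f2 [tau [tauE delta_gt0 delta2 f_or]]]] :=
  quad_real_embeddings d_gt1 d_sqf s2 Fs R.
have [coord coordE] : exists coord : F -> int * int, forall x, x \in @is_int F ->
    x = (coord x).1%:~R + (coord x).2%:~R * quad_omega d s.
  (* Outside O_F the coordinates are junk values. *)
  suff pt x : exists c : int * int, x \in @is_int F ->
      x = c.1%:~R + c.2%:~R * quad_omega d s.
    by have [coord coordE] := boolp.choice pt; exists coord.
  have [/(quad_is_int_coord d_gt1 d_sqf s2 Fs)[a [b xab]]|x_nint] :=
    boolP (x \in @is_int F); first by exists (a, b).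
  by exists (0, 0).
have delta_large : 10 ^+ 12 < f1 (quad_omega d s) - f2 (quad_omega d s).
  rewrite -(@ltr_pXn2r _ 2) ?nnegrE ?exprn_ge0 ?(ltW delta_gt0) //.
  rewrite delta2 -!natrX ltr_nat; apply: leq_ltn_trans hdisc.
  rewrite (leq_exp2r _ _ (ltn0Sn 1)) -!addnA; apply: leq_trans (leq_addr _ _).
  by apply: leq_pmull.
by have := rank_ge8 (quad_omega_is_int d_gt1 s2) coordE
  (quad_denominator s2 Fs) tauE f_or delta_large L_pos L_classic L_univ L_rank.
Qed.
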